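(* For all $n,m\ge1$ and $r\ge0$, $$\operatorname{spec}\widetilde\Delta_{r-1}(D_m^n)=\Big\{\big((n-k)m\big)_{(m-1)^k\binom rk\binom nr}\Big\}_{k=0}^{r}.$$ Consequently, for all $r\ge2$, $$\operatorname{spec}\Delta_{r-1}(D_m^n)=\Big\{\big((n-k)m\big)_{(m-1)^k\binom rk\binom nr}\Big\}_{k=0}^{r}.$$
   Context: A digraph $G=(V,E)$ consists of a finite vertex set $V$ and a set $E$ of ordered pairs of distinct vertices (arrows), written $i\to j$. An elementary $p$-path ($p\ge 0$) is a sequence $i_0\dots i_p$ of vertices, with associated basis symbol $e_{i_0\dots i_p}$; it is regular if $i_{k-1}\ne i_k$ for all $k$, and allowed if $i_{k-1}\to i_k$ for all $k$. $\mathcal R_p$ is the real vector space with basis the regular elementary $p$-paths. The boundary operator $\partial:\mathcal R_p\to\mathcal R_{p-1}$ is $\partial e_{i_0\dots i_p}=\sum_{k=0}^p(-1)^k e_{i_0\dots\widehat{i_k}\dots i_p}$ for $p\ge1$, where every non-regular term on the right is replaced by $0$. $\mathcal A_p\subset\mathcal R_p$ is the span of the allowed elementary $p$-paths, $\Omega_0=\mathcal A_0$, and $\Omega_p=\Omega_p(G)=\{u\in\mathcal A_p:\partial u\in\mathcal A_{p-1}\}$ for $p\ge1$. Then $\partial\Omega_p\subset\Omega_{p-1}$ and $\partial^2=0$. The path chain complex is $0\leftarrow\Omega_0\leftarrow\Omega_1\leftarrow\cdots$ with $\partial e_i=0$ on $\Omega_0$. The augmented chain complex is $0\leftarrow\Omega_{-1}:=\mathbb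 R\leftarrow\Omega_0\leftarrow\Omega_1\leftarrow\cdots$, where $\partial:\Omega_0\to\mathbb R$ is redefined by $\partial e_i=1$ for every vertex $i$ (and $\partial=0$ on $\Omega_{-1}$). Each $\Omega_p$, $p\ge0$, carries the restriction of the canonical inner product on $\mathcal R_p$, for which regular elementary paths are orthonormal, and $\Omega_{-1}=\mathbb R$ carries the standard inner product. With $\partial^*:\Omega_{p-1}\to\Omega_p$ the adjoint of $\partial:\Omega_p\to\Omega_{p-1}$, the operator $\partial\partial^*+\partial^*\partial$ on $\Omega_p$ is denoted $\Delta_p(G)$ when formed in the path chain complex and $\widetilde\Delta_p(G)$ when formed in the augmented chain complex ($p\ge-1$); they coincide for $p\ge1$. The join $X*Y$ of two digraphs has as vertex set the disjoint union of the vertex sets of $X$ and $Y$; its arrows are all arrows of $X$, all arrows of $Y$, and all arrows $x\to y$ with $x\in X$, $y\in Y$. $D_m$ is the digraph with $m$ vertices and no arrows, and $D_m^n=D_m*\cdots*D_m$ ($n$ factors). $\operatorname{spec}A$ is the multiset of eigenvalues of the self-adjoint operator $A$, counted with multiplicity (empty if $A$ acts on the zero space). $(\lambda)_\mu$ inside a multiset means the value $\lambda$ with multiplicity $\mu$ (absent if $\mu=0$). Convention: $0^0=1$; $\binom nr=0$ for $r>n$. *)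

(* Defs.v *)
From HB Require Import structures.
From mathcomp Require Import all_boot all_order all_algebra.
From mathcomp Require Import reals zify.

Set Implicit Arguments.
Unset Strict Implicit.
Unset Printing Implicit Defensive.

Import Order.TTheory GRing.Theory Num.Theory.
Local Open Scope ring_scope.

Record digraph := Digraph {
  vertex :> finType;
  arrow : rel vertex;
  arrow_irr : irreflexive arrow }.

Section Join.
Variables X Y : digraph.

Definition join_arrow : rel (X + Y) := fun a b =>
  match a, b with
  | inl x, inl x' => arrow x x'
  | inr y, inr y' => arrow y y'
  | inl _, inr _ => true
  | inr _, inl _ => false
  end.

Lemma join_arrow_irr : irreflexive join_arrow.
Proof. by case=> z /=; apply: arrow_irr. Qed.

Definition djoin : digraph := Digraph join_arrow_irr.
End Join.

(* D_m *)
Definition discrete (m : nat) : digraph :=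
  @Digraph 'I_m (fun _ _ => false) (fun _ => erefl).

(* X * (X * (... * X)), with n factors; the empty digraph for n = 0. *)
Definition join_power (X : digraph) (n : nat) : digraph :=
  iterop n djoin X (discrete 0).

(* Degrees are shifted by one throughout: the index q is the number of vertices
   of a path, i.e. q = p + 1 for an elementary p-path.  In degree p = -1 (q = 0)
   the only path is the empty one, so that the space of chains is R with its
   standard inner product, and the alternating-sum formula for the boundary of
   a 0-path gives the augmentation e_i |-> 1. *)
Section PathComplex.
Variables (R : realType) (G : digraph).

Definition regular q (t : q.-tuple G) := sorted (fun i j : G => i != j) t.
Definition allowed q (t : q.-tuple G) := sorted (@arrow G) t.

Definition regpath q := {t : q.-tuple G | regular t}.

(* The space R_{q-1}. *)
Definition chain q := {ffun regpath q -> R^o}.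

(* e_t for regular t, and 0 for non-regular t. *)
Definition epath q (t : q.-tuple G) : chain q :=
  [ffun s : regpath q => (val s == t)%:R].

Definition dot q (u v : chain q) : R := \sum_s u s * v s.

Definition face q (k : 'I_q.+1) (t : q.+1.-tuple G) : q.-tuple G :=
  [tuple tnth t (lift k i) | i < q].

Definition bdry_epath q (t : q.+1.-tuple G) : chain q :=
  \sum_(k < q.+1) (-1) ^+ k *: epath (face k t).

Definition bdry_fun q (u : chain q.+1) : chain q :=
  \sum_(s : regpath q.+1) u s *: bdry_epath (val s).

Lemma bdry_fun_linear q : linear (@bdry_fun q).
Proof.
move=> a u v; rewrite /bdry_fun scaler_sumr -big_split; apply: eq_bigr => s _.
by rewrite !ffunE scalerDl scalerA.
Qed.

HB.instance Definition _ q :=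
  GRing.isLinear.Build R (chain q.+1) (chain q) *:%R (@bdry_fun q)
    (@bdry_fun_linear q).

Definition bdry q : 'Hom(chain q.+1, chain q) := linfun (@bdry_fun q).

(* The space A_{q-1}. *)
Definition Aspace q : {vspace chain q} :=
  <<[seq epath t | t in @allowed q]>>%VS.

(* The space Omega_{q-1}. *)
Definition Omega q : {vspace chain q} :=
  match q return {vspace chain q} with
  | 0 => fullv
  | 1 => Aspace 1
  | q'.+2 => (Aspace q'.+2 :&: (bdry q'.+1 @^-1: Aspace q'.+1))%VS
  end.


Lemma bdryE q (s : regpath q.+1) : bdry q (epath (val s)) = bdry_epath (val s).
Proof.
rewrite lfunE /= /bdry_fun (bigD1 s) //= ffunE eqxx scale1r big1 ?addr0 // => s' ne.
by rewrite ffunE (inj_eq val_inj) (negPf ne) scale0r.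
Qed.

Lemma epath_nonreg q (t : q.-tuple G) : ~~ regular t -> epath t = 0.
Proof.
move=> nrt; apply/ffunP => s; rewrite !ffunE.
by case: eqP => // E; move: nrt; rewrite -E (valP s).
Qed.

Lemma nth_face x0 q (k : 'I_q.+1) (t : q.+1.-tuple G) i :
  (i < q)%N -> nth x0 (face k t) i = nth x0 t (bump k i).
Proof.
move=> iq; rewrite -[i]/(val (Ordinal iq)) -tnth_nth tnth_mktuple.
by rewrite (tnth_nth x0).
Qed.

Lemma regular_nth x0 q (t : q.-tuple G) i :
  regular t -> (i.+1 < q)%N -> nth x0 t i != nth x0 t i.+1.
Proof. by move=> /(sortedP x0) H iq; apply: H; rewrite size_tuple. Qed.

Lemma bdry_epath_nonreg q (t : q.+1.-tuple G) :
  ~~ regular t -> bdry_epath t = 0.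
Proof.
pose x0 := thead t => nrt.
have [i iq tiE] : exists2 i, (i < q)%N & nth x0 t i = nth x0 t i.+1.
  have : exists i : 'I_q, nth x0 t i == nth x0 t i.+1.
    apply/existsP; apply: contraR nrt; rewrite negb_exists => /forallP H.
    apply/(sortedP x0) => i; rewrite size_tuple ltnS => iq.
    exact: H (Ordinal iq).
  by case=> i /eqP ?; exists i.
have iq1 : (i < q.+1)%N by exact: ltnW.
have iq2 : (i.+1 < q.+1)%N by [].
rewrite /bdry_epath (bigD1 (Ordinal iq1)) //= (bigD1 (Ordinal iq2)) /=; last first.
  by rewrite -val_eqE /= gtn_eqF.
rewrite big1 ?addr0 => [|k /andP[ki1 ki2]]; last first.
  rewrite epath_nonreg ?scaler0 //; apply/negP => /(regular_nth x0) H.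
  move: ki1 ki2; rewrite -!val_eqE /= => ki1 ki2.
  have [k_lt|k_ge] := ltnP k i.
    case: i iq tiE ki1 ki2 k_lt {iq1 iq2} => // i iq tiE _ _ k_lt.
    move: (H i iq); rewrite !nth_face ?(ltnW iq) //.
    by rewrite /bump -ltnS k_lt (ltnW k_lt) !add1n tiE eqxx.
  have iq' : (i.+1 < q)%N by have := ltn_ord k; lia.
  move: (H i iq'); rewrite !nth_face // /bump.
  have -> : (k <= i)%N = false by lia.
  have -> : (k <= i.+1)%N = false by lia.
  by rewrite !add0n tiE eqxx.
suff -> : face (Ordinal iq1) t = face (Ordinal iq2) t.
  by rewrite exprS mulN1r scaleNr subrr.
apply/val_inj/(@eq_from_nth _ x0); rewrite ?size_tuple // => l lq.
rewrite !nth_face //= /bump; case: (ltngtP i l) => [il|li|<-].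
- by [].
- by [].
- by rewrite tiE.
Qed.

Lemma bdry_epathE q (t : q.+1.-tuple G) : bdry q (epath t) = bdry_epath t.
Proof.
have [rt|nrt] := boolP (regular t).
  by rewrite -[t]/(val (exist _ t rt : regpath q.+1)) bdryE.
by rewrite epath_nonreg // linear0 bdry_epath_nonreg.
Qed.

Lemma face_face q (j : 'I_q.+1) (k : 'I_q.+2) (j' : 'I_q.+2) (k' : 'I_q.+1)
    (t : q.+2.-tuple G) :
  (j < k)%N -> j' = j :> nat -> k = k'.+1 :> nat ->
  face j (face k t) = face k' (face j' t).
Proof.
move=> jk j'E kE; pose x0 := thead t.
apply/val_inj/(@eq_from_nth _ x0); rewrite ?size_tuple // => l lq.
have bq (n : 'I_q.+1) : (bump n l < q.+1)%N.
  by rewrite /bump; case: (n <= l)%N; rewrite ?add1n ?add0n // ltnS // ltnW.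
rewrite !nth_face //; congr nth; rewrite j'E kE; apply/esym.
move: jk; rewrite kE ltnS /bump.
by case: (leqP j l) => jl; case: (leqP k' l) => kl; lia.
Qed.

Lemma bdry_bdry q (u : chain q.+2) : bdry q (bdry q.+1 u) = 0.
Proof.
rewrite [bdry q.+1 u]lfunE /= linear_sum big1 // => s _.
rewrite linearZ /= linear_sum /=; set t := val s; move: t => t.
under eq_bigr do rewrite linearZ /= bdry_epathE scaler_sumr.
rewrite pair_bigA /= (bigID (fun p : 'I_q.+2 * 'I_q.+1 => (p.2 < p.1)%N)) /=.
pose h (p : 'I_q.+2 * 'I_q.+1) : 'I_q.+2 * 'I_q.+1 :=
  (inord p.2, inord p.1.-1).
pose h' (p : 'I_q.+2 * 'I_q.+1) : 'I_q.+2 * 'I_q.+1 :=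
  (inord p.2.+1, inord p.1).
rewrite [X in _ + X](reindex_onto h h') /=; last first.
  move=> [k j] /=; rewrite /h /h' /= => jk; have := ltn_ord j => jq.
  by congr (_, _); apply/val_inj; rewrite /= !inordK //; lia.
rewrite [X in _ + X](eq_bigl (fun p : 'I_q.+2 * 'I_q.+1 => (p.2 < p.1)%N)); last first.
  move=> [k j] /=; have := ltn_ord j; have := ltn_ord k => kq jq.
  rewrite /h /h' /= xpair_eqE -!val_eqE /= !inordK //; lia.
rewrite -big_split big1 ?scaler0 //= => -[k j] /= jk.
have := ltn_ord j; have := ltn_ord k => kq jq.
rewrite (@face_face _ j k (inord j) (inord k.-1)) ?inordK //; try lia.
rewrite !scalerA -!exprD.
have -> : (k + j = (j + k.-1).+1)%N by lia.
by rewrite exprS mulN1r scaleNr addNr.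
Qed.

Lemma bdry_Omega q (u : chain q.+1) : u \in Omega q.+1 -> bdry q u \in Omega q.
Proof.
case: q u => [|[|q]] u; first by move=> _; exact: memvf.
- by rewrite memv_cap -memv_preim => /andP[].
- rewrite [_ \in Omega q.+3]memv_cap -memv_preim => /andP[_ bu].
  by rewrite memv_cap bu -memv_preim bdry_bdry mem0v.
Qed.

(* The elements of Omega q, as a vector space in its own right. *)
Definition omega q := subvs_of (Omega q).

(* The boundary of the augmented complex; by bdry_Omega, vsproj (a projection
   onto Omega q) acts here as a mere corestriction. *)
Definition aug_bdry q : 'Hom(omega q.+1, omega q) :=
  linfun (vsproj (Omega q) \o bdry q \o vsval).

Lemma aug_bdryE q (u : omega q.+1) : vsval (aug_bdry q u) = bdry q (vsval u).
Proof. by rewrite lfunE /= vsprojK // bdry_Omega // subvsP. Qed.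

(* The boundary of the path complex, which vanishes on 0-paths. *)
Definition path_bdry q : 'Hom(omega q.+1, omega q) :=
  if q == 0 then 0 else aug_bdry q.

Definition is_adjoint q q' (f : 'Hom(omega q, omega q'))
    (g : 'Hom(omega q', omega q)) :=
  forall u v, dot (vsval (f u)) (vsval v) = dot (vsval u) (vsval (g v)).

Lemma dotDl q (a : R) (u u' v : chain q) :
  dot (a *: u + u') v = a * dot u v + dot u' v.
Proof.
rewrite /dot mulr_sumr -big_split; apply: eq_bigr => s _.
by rewrite !ffunE mulrDl mulrA.
Qed.

Lemma dotC q (u v : chain q) : dot u v = dot v u.
Proof. by apply: eq_bigr => s _; rewrite mulrC. Qed.

Lemma dotBr q (u v v' : chain q) : dot u (v - v') = dot u v - dot u v'.
Proof.
rewrite /dot -sumrB; apply: eq_bigr => s _.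
by rewrite !ffunE mulrBr.
Qed.

Lemma dot_eq0 q (u : chain q) : dot u u = 0 -> u = 0.
Proof.
move=> /eqP; rewrite psumr_eq0 => [/allP u0|s _]; last exact: sqr_ge0.
apply/ffunP => s; rewrite ffunE; apply/eqP; rewrite -sqrf_eq0 expr2.
by apply: u0; rewrite mem_index_enum.
Qed.

Lemma adjoint_subproof q q' (f : 'Hom(omega q, omega q')) :
  {g | is_adjoint f g}.
Proof.
pose phi0 r (v u : omega r) : R^o := dot (vsval u) (vsval v).
have phi0l r (v : omega r) : linear (phi0 r v).
  by move=> a x y; rewrite /phi0 linearP dotDl.
pose phiL r (v : omega r) : {linear omega r -> R^o} :=
  HB.pack (phi0 r v) (GRing.isLinear.Build R (omega r) R^o *:%R _ (phi0l r v)).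
pose phi1 r (v : omega r) : 'Hom(omega r, R^o) := linfun (phiL r v).
have phi1l r : linear (@phi1 r).
  move=> a x y; apply/lfunP => u; rewrite add_lfunE scale_lfunE !lfunE /=.
  by rewrite /phi0 linearP dotC dotDl !(dotC (vsval u)).
pose phi2 r : {linear omega r -> 'Hom(omega r, R^o)} :=
  HB.pack (@phi1 r)
    (GRing.isLinear.Build R (omega r) 'Hom(omega r, R^o) *:%R _ (phi1l r)).
pose phi r : 'Hom(omega r, 'Hom(omega r, R^o)) := linfun (phi2 r).
have phiE r u v : phi r v u = dot (vsval u) (vsval v) by rewrite !lfunE.
have phi_inj r : lker (phi r) == 0%VS.
  apply/lker0P => u v E0.
  have E : dot (vsval (u - v)) (vsval u) = dot (vsval (u - v)) (vsval v).
    by rewrite -!phiE E0.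
  apply/eqP; rewrite -subr_eq0; apply/eqP/val_inj/dot_eq0.
  by rewrite [X in dot _ X]linearB dotBr E subrr.
have phi_surj r : limg (phi r) = fullv.
  apply/eqP; rewrite eqEdim subvf limg_dim_eq ?(eqP (phi_inj r)) ?capv0 //.
  by rewrite !dimvf /dim /= muln1.
pose pb0 (h : 'Hom(omega q', R^o)) : 'Hom(omega q, R^o) := (h \o f)%VF.
have pbl : linear pb0.
  by move=> a x y; rewrite /pb0 comp_lfunDl comp_lfunZl.
pose pb : {linear 'Hom(omega q', R^o) -> 'Hom(omega q, R^o)} :=
  HB.pack pb0 (GRing.isLinear.Build R 'Hom(omega q', R^o) 'Hom(omega q, R^o)
    *:%R _ pbl).
exists ((phi q)^-1 \o linfun pb \o phi q')%VF => u v.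
rewrite -!phiE !comp_lfunE limg_lfunVK ?phi_surj ?memvf // lfunE /=.
by rewrite (lfunE pb) comp_lfunE.
Qed.

Definition adjoint q q' (f : 'Hom(omega q, omega q')) :
    'Hom(omega q', omega q) :=
  sval (adjoint_subproof f).

Lemma adjointP q q' (f : 'Hom(omega q, omega q')) : is_adjoint f (adjoint f).
Proof. exact: svalP (adjoint_subproof f). Qed.

Lemma adjoint_unique q q' (f : 'Hom(omega q, omega q')) g :
  is_adjoint f g -> g = adjoint f.
Proof.
move=> fg; apply/lfunP => v; apply/eqP; rewrite -subr_eq0.
apply/eqP/val_inj/dot_eq0; set w := _ - _.
by rewrite [X in dot _ X]linearB dotBr -fg -adjointP subrr.
Qed.

(* omega 0 is the bottom of the complex, where d = 0. *)
Definition hodge_laplacian (d : forall q, 'Hom(omega q.+1, omega q)) q :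
    'End(omega q) :=
  match q return 'End(omega q) with
  | 0 => (d 0 \o adjoint (d 0))%VF
  | q'.+1 => (d q'.+1 \o adjoint (d q'.+1))%VF + (adjoint (d q') \o d q')%VF
  end.

(* Delta~_{q-1} *)
Definition aug_laplacian q : 'End(omega q) := hodge_laplacian aug_bdry q.

(* Delta_p, on Omega_p = omega p.+1 *)
Definition path_laplacian p : 'End(omega p.+1) := hodge_laplacian path_bdry p.+1.

End PathComplex.

(* s lists, in some order, the eigenvalues of f with multiplicity; the
   multiplicity is the dimension of the eigenspace. *)
Definition is_spectrum (R : realType) (vT : vectType R) (f : 'End(vT))
    (s : seq R) :=
  forall a : R, count_mem a s = \dim (passmx.leigenspace f a).

(* Main.v *)
Require Import Defs.
From HB Require Import structures.
From mathcomp Require Import all_boot all_order all_algebra.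
From mathcomp Require Import reals.

Set Implicit Arguments.
Unset Strict Implicit.
Unset Printing Implicit Defensive.

Import Order.TTheory GRing.Theory Num.Theory.
Local Open Scope ring_scope.

(** The arrows of D_m^n are transitive, so faces of allowed paths are allowed
    and Omega is spanned by the allowed paths. An allowed path picks at most one
    vertex in each of the n layers: it is a partial function f from the layers
    to the vertices of D_m, and its degree plus one is the size of its domain.
    In other words the augmented complex is the tensor product of n copies of
    the complex R <- R^m of D_m.

    The boundary of f is the sum over the occupied layers i of the signed path
    with layer i vacated; its adjoint is the sum over the vacant layers of the
    signed paths with one more vertex. Vacating a layer and filling another one
    anticommute ([sgn_anticomm]), so in the Laplacian only the terms that vacate
    and fill the same layer survive ([aug_laplacian_omega_path]): the Laplacian
    is a sum over the layers, where a vacant layer contributes multiplication by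
    m and an occupied layer contributes the all-ones matrix J acting on its
    vertex.

    In a single layer J has the eigenvalue m on the sum of the vertices, and 0
    with multiplicity m - 1 on differences of vertices. Tensor products of these
    vectors form an eigenbasis, whose labels are again partial functions x; the
    eigenvalue of x is m times the number of layers that do not carry a vector
    of the kernel of J ([factor_laplacian_eigen], [sum_eigval]). If x occupies r
    layers, of which k carry a vector of the kernel, this is (n - k) m, and there
    are C(n, r) C(r, k) (m - 1)^k such labels ([card_supp_nonbase]). *)

(** * Eigenbases, tensor inverses and sorted sequences *)

(** In an eigenbasis the equation f u = a u decouples coordinate by coordinate,
    so the eigenspace of a is spanned by the basis vectors of eigenvalue a. The
    basis is indexed by the part P of a finite type, which is how the tensor
    eigenbasis of a given degree is indexed. *)
Lemma dim_leigenspace_eigenbasis (K : fieldType) (vT : vectType K)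
    (I : finType) (P : pred I) (b : I -> vT) (lam : I -> K) (f : 'End(vT)) :
  (forall x, P x -> f (b x) = lam x *: b x) ->
  (forall c : I -> K, \sum_(x | P x) c x *: b x = 0 ->
     forall x, P x -> c x = 0) ->
  (forall u, exists c : I -> K, u = \sum_(x | P x) c x *: b x) ->
  forall a, \dim (passmx.leigenspace f a) = #|[pred x | P x && (lam x == a)]|.
Proof.
move=> f_b b_free b_span a; set A := [pred x | _].
pose X := [tuple b (enum_val i) | i < #|A|].
have XE (i : 'I_#|A|) : X`_i = b (enum_val i).
  by rewrite -(tnth_nth 0 X i) tnth_mktuple.
have freeX : free X.
  apply/freeP => k k0 i.
  pose c x := \sum_(j < #|A| | enum_val j == x) k j.
  have cE j : c (enum_val j) = k j.
    by rewrite /c (eq_bigl _ _ (inj_eq enum_val_inj ^~ j)) big_pred1_eq.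
  rewrite -cE; apply: b_free; last by have /andP[] := enum_valP i.
  rewrite (bigID A) /= [X in _ + X]big1 ?addr0; last first.
    move=> x /andP[_ xA]; rewrite /c big_pred0 ?scale0r // => j.
    by apply/negbTE; apply: contraNneq xA => <-; exact: enum_valP j.
  rewrite (eq_bigl (mem A)) /= => [|x]; last by rewrite !inE; case: (P x).
  rewrite big_enum_val -[RHS]k0; apply: eq_bigr => j _.
  by rewrite cE XE.
suff -> : passmx.leigenspace f a = <<X>>%VS.
  by rewrite (eqP freeX) size_tuple.
apply/vspaceP => u.
rewrite memv_ker !lfun_simp subr_eq0.
apply/eqP/idP => [fu|].
  have [c uE] := b_span u.
  have c0 x : P x -> c x * (lam x - a) = 0.
    apply: (b_free (fun x => c x * (lam x - a))).
    rewrite -[RHS](subrr (f u)) {2}fu uE linear_sum scaler_sumr -sumrB.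
    apply: eq_bigr => y Py; rewrite linearZ /= f_b // !scalerA -scalerBl.
    by rewrite mulrBr [a * _]mulrC.
  rewrite uE; apply: rpred_sum => x Px; have [lx|nlx] := eqVneq (lam x) a.
    have xA : x \in A by rewrite inE Px lx eqxx.
    apply/rpredZ/memv_span; rewrite -(enum_rankK_in xA xA).
    by apply/mapP; exists (enum_rank_in xA x); rewrite ?mem_enum.
  have /eqP := c0 x Px; rewrite mulf_eq0 subr_eq0 (negPf nlx) orbF => /eqP ->.
  by rewrite scale0r mem0v.
move=> /coord_span ->; rewrite linear_sum scaler_sumr; apply: eq_bigr => i _.
rewrite linearZ /= XE; have /andP[Px /eqP <-] := enum_valP i.
by rewrite f_b // !scalerA mulrC.
Qed.

(** The Kronecker product of copies of M and of N multiply factor by factor, by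
    distributivity of the product over the sums. *)
Lemma tensor_inverse (K : comPzRingType) (I X : finType) (M N : X -> X -> K) :
  (forall a c, \sum_b M a b * N b c = (a == c)%:R) ->
  forall x y : {ffun I -> X},
    \sum_(f : {ffun I -> X}) (\prod_i M (x i) (f i)) * (\prod_i N (f i) (y i))
      = (x == y)%:R.
Proof.
move=> MN x y; under eq_bigr => f _ do rewrite -big_split /=.
rewrite -(bigA_distr_bigA (fun i o => M (x i) o * N o (y i))).
under eq_bigr => i _ do rewrite MN.
have [->|] := eqVneq x y; first by rewrite big1 // => i _; rewrite eqxx.
case/eqP/ffunP/eqfunP/forallPn => i xyi.
by rewrite (bigD1 i) //= (negPf xyi) mul0r.
Qed.

(** It turns the position of a vertex in a path, which fixes the sign of the
    face that omits it, into a count that does not refer to the path as a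
    list. *)
Lemma index_sorted_count (T : eqType) (r : rel T) (s : seq T) x :
  transitive r -> irreflexive r -> sorted r s -> x \in s ->
  index x s = count (r ^~ x) s.
Proof.
move=> r_tr r_irr; elim: s => //= y s IH rs; rewrite inE eq_sym => xs.
have [yx|nyx] := eqVneq y x.
  rewrite yx r_irr; apply/esym/eqP; rewrite -leqn0 leqNgt -has_count.
  apply/hasPn => z zs.
  have := order_path_min r_tr rs; rewrite yx => /allP/(_ z zs) rxz.
  by apply/negP => rzx; have := r_tr _ _ _ rxz rzx; rewrite r_irr.
rewrite (negPf nyx) /= in xs; rewrite IH ?(path_sorted rs) //.
by have /allP/(_ x xs) -> := order_path_min r_tr rs.
Qed.

(** * Partial functions and their signs *)

Section PartialFunctions.
Variables n m : nat.

(** An allowed path of D_m^n visits strictly increasing layers, at one vertex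
    per layer: it is a partial function from layers to the vertices of D_m.
    D_m is taken with m.+1 vertices, so that the vertex ord0 always exists. *)
Definition partial_fun := {ffun 'I_n -> option 'I_m.+1}.

Implicit Types (f g : partial_fun) (i j : 'I_n) (o : option 'I_m.+1).

Definition upd f i o : partial_fun := [ffun j => if j == i then o else f j].

Definition supp f : seq 'I_n := [seq i <- enum 'I_n | f i].

Lemma upd_eq f i o : upd f i o i = o.
Proof. by rewrite ffunE eqxx. Qed.

Lemma upd_ne f i j o : j != i -> upd f i o j = f j.
Proof. by move=> /negPf ji; rewrite ffunE ji. Qed.

Lemma upd_upd f i o o' : upd (upd f i o) i o' = upd f i o'.
Proof. by apply/ffunP => j; rewrite !ffunE; case: eqP. Qed.

Lemma upd_id f i : upd f i (f i) = f.
Proof. by apply/ffunP => j; rewrite ffunE; case: eqP => // ->. Qed.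

Lemma updC f i j o o' : i != j -> upd (upd f i o) j o' = upd (upd f j o') i o.
Proof.
move=> ij; apply/ffunP => l; rewrite !ffunE.
by have [->|//] := eqVneq l j; rewrite eq_sym (negPf ij).
Qed.

Lemma mem_supp f i : (i \in supp f) = f i.
Proof. by rewrite mem_filter mem_enum andbT. Qed.

Lemma supp_uniq f : uniq (supp f).
Proof. by rewrite filter_uniq // enum_uniq. Qed.

Lemma big_supp (V : nmodType) f (F : 'I_n -> V) :
  \sum_(i <- supp f) F i = \sum_(i | f i) F i.
Proof. by rewrite big_filter big_enum_cond. Qed.

Lemma size_supp f : size (supp f) = #|[pred i | f i : bool]|.
Proof. by rewrite size_filter -sum1_count big_enum_cond sum1_card. Qed.

Lemma size_supp_upd f i o :
  size (supp (upd f i o)) = (o + size (supp (upd f i None)))%N.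
Proof.
rewrite !size_supp (cardD1 i) [in RHS](cardD1 i) !inE !upd_eq addnA addn0.
congr addn; apply: eq_card => j; rewrite !inE.
by case: eqVneq => //= ji; rewrite !upd_ne.
Qed.

Lemma size_supp_remove f i :
  f i -> size (supp f) = (size (supp (upd f i None))).+1.
Proof. by move=> fi; rewrite -{1}(upd_id f i) size_supp_upd fi. Qed.

Lemma sorted_supp f : sorted (fun i j => i < j)%N (supp f).
Proof.
apply: sorted_filter => [j i l|]; first exact: ltn_trans.
by have := iota_ltn_sorted 0 n; rewrite -val_enum_ord sorted_map.
Qed.

(** It groups the partial functions into slices that differ only at layer i,
    the sets of paths on which the Laplacian of the i-th factor acts. *)
Lemma fill_sum (V : nmodType) i (K : partial_fun -> V) :
  \sum_(f : partial_fun | f i) K f =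
    \sum_(g : partial_fun | ~~ g i) \sum_a K (upd g i (Some a)).
Proof.
rewrite pair_big /= (reindex_onto
  (fun p : partial_fun * 'I_m.+1 => upd p.1 i (Some p.2))
  (fun f => (upd f i None, odflt ord0 (f i)))) /=; last first.
  by move=> f fi; rewrite upd_upd -[RHS](upd_id f i); case: (f i) fi.
apply: eq_bigl => -[g a]; rewrite !upd_eq upd_upd xpair_eqE eqxx andbT /= andbT.
apply/eqP/idP => [<-|]; first by rewrite upd_eq.
by case E: (g i) => // _; rewrite -E upd_id.
Qed.

Section Sign.
Variable R : comPzRingType.

(** The sign, in the boundary, of the face that omits layer i. Written as a
    product over the occupied layers below i it also makes sense when i is not
    occupied, as the adjoint of the boundary requires. *)
Definition sgn f i : R := \prod_(j < n | (j < i)%N) (if f j : bool then -1 else 1).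

Lemma sgn_upd_le f i j o : (i <= j)%N -> sgn (upd f j o) i = sgn f i.
Proof.
move=> ij; apply: eq_bigr => l li; rewrite upd_ne //.
by apply: contraTneq li => ->; rewrite -leqNgt.
Qed.

Lemma sgn_upd_lt f i j o :
  (j < i)%N -> isSome o = ~~ f j -> sgn (upd f j o) i = - sgn f i.
Proof.
move=> ji oE; rewrite /sgn (bigD1 j) //= [in RHS](bigD1 j) //= upd_eq oE.
rewrite -mulNr; congr (_ * _); first by case: (isSome _); rewrite /= ?opprK.
by apply: eq_bigr => l /andP[_ lj]; rewrite upd_ne.
Qed.

Lemma sgn_sqr f i : sgn f i * sgn f i = 1.
Proof.
by rewrite -big_split big1 //= => j _; case: ifP; rewrite ?mulrNN mulr1.
Qed.

(** Inserting a vertex at one layer and removing the vertex of another one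
    anticommute: exactly one of the two operations changes, below the layer of
    the other, the number of occupied layers. All the off-diagonal terms of the
    Laplacian cancel for this reason. *)
Lemma sgn_anticomm f i j o : i != j -> ~~ f i -> f j -> isSome o ->
  sgn f i * sgn (upd f i o) j = - (sgn f j * sgn (upd f j None) i).
Proof.
move=> ij fi fj so; case: (ltngtP i j) => [lt_ij|lt_ji|/val_inj eq_ij].
- rewrite sgn_upd_lt ?so // sgn_upd_le; last exact: ltnW.
  by rewrite mulrN mulrC.
- rewrite sgn_upd_le; last exact: ltnW.
  by rewrite sgn_upd_lt ?fj // mulrN opprK mulrC.
- by rewrite eq_ij eqxx in ij.
Qed.

Lemma sgn_index f i : f i -> sgn f i = (-1) ^+ index i (supp f).
Proof.
move=> fi; have lt_tr : transitive (fun j l : 'I_n => j < l)%N.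
  by move=> j l k; apply: ltn_trans.
rewrite (index_sorted_count lt_tr _ (sorted_supp f)) ?mem_supp //; last first.
  by move=> j; apply: ltnn.
rewrite -sum1_count big_filter_cond big_enum_cond /sgn -big_mkcondr /=.
by rewrite prodr_const -sum1_card; congr (_ ^+ _); apply: eq_bigl => j; rewrite andbC.
Qed.
End Sign.
End PartialFunctions.

(** * Tensor eigenvectors *)

Section TensorEigenbasis.
Variables (R : numFieldType) (n m : nat).

Implicit Types (o : option 'I_m.+1) (a b c : 'I_m.+1).

Lemma sum_option (V : nmodType) (F : option 'I_m.+1 -> V) :
  \sum_o F o = F None + \sum_a F (Some a).
Proof.
rewrite (bigD1 None) //=; congr (_ + _).
rewrite (reindex_onto Some (odflt ord0)) /=; last by case.
by apply: eq_bigl => a; rewrite eqxx.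
Qed.

(** The complex of a single factor with m.+1 vertices has basis None in degree
    -1 and the vertices Some a in degree 0. Row o lists the coordinates
    of an eigenvector of its Laplacian: the generator of degree -1 for None,
    the sum of all vertices for Some ord0, and the difference e_a - e_ord0 for
    any other a. *)
Definition eigvec o o' : R :=
  match o, o' with
  | None, None => 1
  | Some a, Some b => if a == ord0 then 1 else (b == a)%:R - (b == ord0)%:R
  | _, _ => 0
  end.

(** Row Some a: the vertex a is the average of all vertices plus its deviation from
    the average, rewritten on the differences e_b - e_ord0. *)
Definition eigvec_inv o o' : R :=
  match o, o' with
  | None, None => 1
  | Some a, Some b =>
      if b == ord0 then m.+1%:R^-1 else (b == a)%:R - m.+1%:R^-1
  | _, _ => 0
  end.

(** The Laplacian of the factor is multiplication by the number of its
    vertices in degree -1 and the all-ones matrix in degree 0. *)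
Definition eigval o : R :=
  match o with
  | None => m.+1%:R
  | Some a => (a == ord0)%:R * m.+1%:R
  end.

Lemma sum_delta (F : 'I_m.+1 -> R) a : \sum_b (b == a)%:R * F b = F a.
Proof.
rewrite (bigD1 a) //= eqxx mul1r big1 ?addr0 // => b /negPf ->.
by rewrite mul0r.
Qed.

Lemma sum_delta1 a : \sum_b (b == a)%:R = 1 :> R.
Proof.
by rewrite -[RHS](sum_delta (fun=> 1) a); under [RHS]eq_bigr do rewrite mulr1.
Qed.

Lemma eigvec_sum a : \sum_b eigvec (Some a) (Some b) = eigval (Some a).
Proof.
rewrite /=; case: eqVneq => [_|a0]; first by rewrite mul1r sumr_const card_ord.
by rewrite mul0r sumrB !sum_delta1 subrr.
Qed.

Lemma eigvecK o o' : \sum_b eigvec o b * eigvec_inv b o' = (o == o')%:R.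
Proof.
have mV : \sum_(b < m.+1) m.+1%:R^-1 = 1 :> R.
  by rewrite sumr_const card_ord -[LHS]mulr_natl divff ?pnatr_eq0.
rewrite sum_option; case: o o' => [a|] [c|] /=; last first.
- by rewrite mulr1 big1 ?addr0 // => b _; rewrite mulr0.
- by rewrite mulr0 add0r big1 // => b _; rewrite mul0r.
- by rewrite mul0r add0r big1 // => b _; rewrite mulr0.
rewrite mul0r add0r [RHS](_ : _ = (a == c)%:R) //.
have [->|a0] := eqVneq a ord0.
  under eq_bigr do rewrite mul1r; have [_|c0] := eqVneq c ord0; first by rewrite mV.
  under eq_bigr => b _ do rewrite [c == b]eq_sym.
  by rewrite sumrB sum_delta1 mV subrr.
under eq_bigr do rewrite mulrBl.
rewrite sumrB !(sum_delta (fun b => eigvec_inv (Some b) (Some c))) /=.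
have [->|c0] := eqVneq c ord0; first by rewrite subrr (negPf a0).
by rewrite opprB addrA subrK subr0 eq_sym.
Qed.

Lemma eigvec_invK o o' : \sum_b eigvec_inv o b * eigvec b o' = (o == o')%:R.
Proof.
have m0 : m.+1%:R != 0 :> R by rewrite pnatr_eq0.
rewrite sum_option; case: o o' => [a|] [c|] /=; last first.
- by rewrite mulr1 big1 ?addr0 // => b _; rewrite mulr0.
- by rewrite mulr0 add0r big1 // => b _; rewrite mul0r.
- by rewrite mul0r add0r big1 // => b _; rewrite mulr0.
rewrite mul0r add0r [RHS](_ : _ = (a == c)%:R) //.
pose F b : R := ((b == a)%:R - m.+1%:R^-1) * ((b == c)%:R - (c == ord0)%:R).
have F0 : F ord0 = 0 by rewrite /F [c == _]eq_sym subrr mulr0.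
have sumF : \sum_b F b = (a == c)%:R - m.+1%:R^-1.
  under eq_bigr do rewrite /F mulrBl.
  rewrite sumrB -mulr_sumr sumrB sum_delta1 sumr_const card_ord.
  rewrite (sum_delta (fun b => (b == c)%:R - (c == ord0)%:R)).
  rewrite mulrBr mulr1 -[X in _ * X]mulr_natl mulrA mulVf // mul1r.
  by rewrite opprB addrA subrK.
rewrite (bigD1 ord0) //= mulr1 -[RHS](subrK m.+1%:R^-1) -sumF addrC.
congr (_ + _); rewrite [RHS](bigD1 ord0) //= F0 add0r.
by apply: eq_bigr => b /negPf b0; rewrite b0 /F [c == b]eq_sym.
Qed.

Notation partial_fun := (partial_fun n m).

(** The coordinates of a tensor product of eigenvectors of the factors; the
    label x of such a vector is itself a partial function. *)
Definition tensor_eigvec (x f : partial_fun) : R := \prod_i eigvec (x i) (f i).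
Definition tensor_eigvec_inv (f x : partial_fun) : R :=
  \prod_i eigvec_inv (f i) (x i).

Lemma tensor_eigvecK (x y : partial_fun) :
  \sum_f tensor_eigvec x f * tensor_eigvec_inv f y = (x == y)%:R.
Proof. exact/tensor_inverse/eigvecK. Qed.

Lemma tensor_eigvec_invK (f g : partial_fun) :
  \sum_x tensor_eigvec_inv f x * tensor_eigvec x g = (f == g)%:R.
Proof. exact/tensor_inverse/eigvec_invK. Qed.

Lemma tensor_eigvec_size (x f : partial_fun) :
  size (supp x) != size (supp f) -> tensor_eigvec x f = 0.
Proof.
move=> xf; have [i xfi] : exists i, (x i : bool) != f i.
  apply/existsP; apply: contraR xf; rewrite negb_exists => /forallP xf.
  rewrite !size_supp; apply/eqP/eq_card => i; rewrite !inE.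
  by have := xf i; rewrite negbK => /eqP.
by rewrite /tensor_eigvec (bigD1 i) //=; case: (x i) (f i) xfi => [a|] [b|] //;
  rewrite mul0r.
Qed.

(** The Laplacian of the i-th factor acting on the i-th tensor component, for
    an arbitrary family E in place of the standard basis. *)
Definition factor_laplacian (V : lmodType R) (E : partial_fun -> V) i
    (f : partial_fun) : V :=
  if f i : bool then \sum_a E (upd f i (Some a)) else m.+1%:R *: E f.

(** Only the component i matters: on the slice of all f that agree with a fixed
    g off i, the tensor coordinates are a constant c times the coordinates of a
    single-factor eigenvector. *)
Lemma factor_laplacian_eigen (V : lmodType R) (E : partial_fun -> V) i x :
  \sum_f tensor_eigvec x f *: factor_laplacian E i f
    = eigval (x i) *: \sum_f tensor_eigvec x f *: E f.
Proof.
have split_i K : \sum_f K f = \sum_(g : partial_fun | ~~ g i)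
    (K g + \sum_a K (upd g i (Some a))) :> V.
  by rewrite (bigID (fun f : partial_fun => ~~ f i)) big_split /=
             -fill_sum; under [X in _ + X = _]eq_bigl do rewrite negbK.
rewrite !split_i scaler_sumr; apply: eq_bigr => g gi.
pose c : R := \prod_(j | j != i) eigvec (x j) (g j).
have vE o : tensor_eigvec x (upd g i o) = eigvec (x i) o * c.
  rewrite /tensor_eigvec (bigD1 i) //= upd_eq; congr (_ * _).
  by apply: eq_bigr => j ji; rewrite upd_ne.
have -> : tensor_eigvec x g = eigvec (x i) None * c.
  by rewrite -vE -[in LHS](upd_id g i); case: (g i) gi.
rewrite /factor_laplacian (negPf gi).
under eq_bigr => a _.
  rewrite vE upd_eq /=; under eq_bigr do rewrite upd_upd; over.
under [in RHS]eq_bigr => a _ do rewrite vE.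
rewrite -scaler_suml -mulr_suml.
case: (x i) => [a|]; last first.
  rewrite /= big1 // [X in _ = _ *: (_ + X)]big1 => [|a _].
    by rewrite mul0r scale0r !addr0 !mul1r !scalerA mulrC.
  by rewrite mul0r scale0r.
rewrite eigvec_sum.
rewrite ![eigvec _ None]/= !mul0r !scale0r !add0r /=.
case: eqVneq => [_|a0]; last by rewrite !mul0r !scale0r.
rewrite scaler_sumr scaler_sumr; apply: eq_bigr => b _.
by rewrite scalerA !mul1r.
Qed.

End TensorEigenbasis.

(** * Counting the labels of an eigenvalue *)

Section Count.
Variables n m : nat.
Notation partial_fun := (partial_fun n m).

(** The labels of the kernel of the single-factor Laplacian. *)
Definition nonbase (o : option 'I_m.+1) : bool :=
  if o is Some a then a != ord0 else false.

Definition nonbase_set (x : partial_fun) : {set 'I_n} :=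
  [set i | nonbase (x i)].

Lemma card_nonbase : #|[pred o | nonbase o]| = m.
Proof.
rewrite -sum1_card big_mkcond sum_option /= add0r -big_mkcond /=.
by rewrite sum1_card cardC1 card_ord.
Qed.

(** Choose the r occupied layers, then the k layers among them with a nonbase
    label, then these labels freely; the other labels are forced. *)
Lemma card_supp_nonbase r k :
  #|[pred x : partial_fun | (size (supp x) == r) && (#|nonbase_set x| == k)]|
    = (m ^ k * 'C(r, k) * 'C(n, r))%N.
Proof.
pose S (x : partial_fun) := [set i | isSome (x i)].
have TS x : nonbase_set x \subset S x.
  by apply/subsetP => i; rewrite !inE; case: (x i).
have fiber (A B : {set 'I_n}) : B \subset A ->
  #|[pred x | (S x == A) && (nonbase_set x == B)]| = (m ^ #|B|)%N.
  move=> BA; pose F i := if i \in B then [pred o | nonbase o]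
                       else pred1 (if i \in A then Some ord0 else None).
  rewrite (eq_card (B := family F)) => [|x].
    rewrite card_family foldrE big_image /= (bigID (mem B)) /=.
    rewrite (eq_bigr (fun=> m)) => [|i iB]; last by rewrite /F iB card_nonbase.
    rewrite prod_nat_const big1 ?muln1 // => i iB.
    by rewrite /F (negPf iB) card1.
  rewrite inE; apply/andP/familyP => [[/eqP SA /eqP TB] i|xF].
    rewrite /F -SA -TB !inE; case: (x i) => [a|] //=.
    by case: eqVneq => [->|].
  split; apply/eqP/setP => i; have := xF i; rewrite /F !inE.
    case: ifP => [iB|_]; first by rewrite (subsetP BA) //= inE; case: (x i).
    by move=> /eqP ->; case: ifP.
  by case: ifP => // _ /eqP ->; case: ifP.
rewrite -sum1_card.
rewrite (partition_big (fun x => (S x, nonbase_set x))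
  (fun p => (#|p.1| == r) && ((p.2 \subset p.1) && (#|p.2| == k)))) /=; last first.
  move=> x /andP[xr xk]; rewrite TS xk !andbT -(eqP xr) size_supp.
  by rewrite cardsE.
rewrite (eq_bigr (fun=> m ^ k)%N) => [|[A B] /= /and3P[/eqP Ar BA /eqP Bk]]; last first.
  rewrite -[in RHS]Bk -(fiber A B BA) -[RHS]sum1_card; apply: eq_bigl => x.
  rewrite !inE xpair_eqE; case: (eqVneq (S x) A) => [SA|_] /=; last by rewrite andbF.
  case: (eqVneq (nonbase_set x) B) => [TB|_] /=; last by rewrite andbF.
  by rewrite TB Bk eqxx size_supp -Ar -SA cardsE eqxx.
rewrite -(pair_big_dep (fun A : {set 'I_n} => #|A| == r)
  (fun A B : {set 'I_n} => (B \subset A) && (#|B| == k)) (fun _ _ => m ^ k)%N) /=.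
rewrite (eq_bigr (fun=> 'C(r, k) * m ^ k)%N) => [|A /eqP Ar]; last first.
  by rewrite -Ar -cards_draws sum_nat_const -cardsE.
rewrite sum_nat_const -cardsE card_draws card_ord.
by rewrite [RHS]mulnC [('C(r, k) * _)%N]mulnC.
Qed.

(** Each layer contributes m.+1, unless its label lies in the kernel. *)
Lemma sum_eigval (R : numFieldType) (x : partial_fun) :
  \sum_i eigval R (x i) = (n%:R - #|nonbase_set x|%:R) * m.+1%:R.
Proof.
have -> : n%:R - #|nonbase_set x|%:R = \sum_i (1 - (i \in nonbase_set x)%:R) :> R.
  by rewrite sumrB sumr_const card_ord -natr_sum -big_mkcond sum1_card.
rewrite mulr_suml; apply: eq_bigr => i _; rewrite inE.
case: (x i) => [a|] /=; last by rewrite subr0 mul1r.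
by case: eqP; rewrite /= ?subr0 ?subrr.
Qed.

Lemma count_mem_spectrum (R : numFieldType) r (e : R) :
  count_mem e (flatten [seq nseq (m ^ k * 'C(r, k) * 'C(n, r))%N
                                 ((n%:R - k%:R) * m.+1%:R : R)
                       | k <- iota 0 r.+1])
    = #|[pred x : partial_fun |
          (size (supp x) == r) && (\sum_i eigval R (x i) == e)]|.
Proof.
rewrite count_flatten -map_comp sumnE big_map -[iota _ _]/(index_iota 0 r.+1).
rewrite big_mkord -sum1_card.
have nz_le (x : partial_fun) : (#|nonbase_set x| <= size (supp x))%N.
  rewrite size_supp -cardsE; apply/subset_leq_card/subsetP => i.
  by rewrite !inE; case: (x i).
rewrite (partition_big (fun x => inord #|nonbase_set x| : 'I_r.+1) xpredT) //.
apply: eq_bigr => k _; rewrite /= count_nseq -card_supp_nonbase -sum1_card.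
rewrite [RHS](eq_bigl (fun x : partial_fun =>
  ((n%:R - k%:R) * m.+1%:R == e) &&
    ((size (supp x) == r) && (#|nonbase_set x| == k)))); last first.
  move=> x; rewrite !inE; case: eqVneq => //= [xr|]; last by rewrite andbF.
  rewrite -val_eqE /= inordK ?ltnS -?xr // sum_eigval.
  by case: (_ =P val k) => [->|]; rewrite ?andbT ?andbF.
rewrite -[pred1 e _]/(_ == e).
by case: (_ =P e) => _; rewrite /= ?mul1n // mul0n big_pred0.
Qed.
End Count.

(** * The Laplacian on allowed paths *)

Section PathsOfLayeredDigraph.
Variables (R : realType) (n m : nat) (G : digraph).
Variable psi : 'I_n * 'I_m.+1 -> G.
Hypothesis psi_bij : bijective psi.
Hypothesis psi_arrow : forall p p', arrow (psi p) (psi p') = (p.1 < p'.1)%N.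

Notation partial_fun := (partial_fun n m).
Implicit Types (f g x : partial_fun) (q : nat).

Lemma arrow_trans : transitive (@arrow G).
Proof.
case: psi_bij => psi' _ psiK y x z; rewrite -(psiK x) -(psiK y) -(psiK z).
by rewrite !psi_arrow; apply: ltn_trans.
Qed.

Definition path_of f : seq G := [seq psi (i, odflt ord0 (f i)) | i <- supp f].

Lemma size_path_of f : size (path_of f) = size (supp f).
Proof. exact: size_map. Qed.

Lemma sorted_path_of f : sorted (@arrow G) (path_of f).
Proof.
rewrite sorted_map; apply: sub_sorted (sorted_supp f) => i j ij.
by rewrite /= psi_arrow.
Qed.

Lemma mem_path_of f i a : (psi (i, a) \in path_of f) = (f i == Some a).
Proof.
apply/mapP/eqP => [[j]|fi].
  rewrite mem_supp => fj /(bij_inj psi_bij)[-> ->].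
  by case: (f j) fj.
by exists i; rewrite ?mem_supp fi.
Qed.

Lemma path_of_inj : injective path_of.
Proof.
move=> f g fg; apply/ffunP => i; apply/eqP.
have fgE a : (f i == Some a) = (g i == Some a) by rewrite -!mem_path_of fg.
case E: (f i) => [a|]; first by rewrite eq_sym -fgE E.
by case E': (g i) => [a|] //; have := fgE a; rewrite E' E eqxx.
Qed.

(** Two vertices of one layer are not joined by an arrow, while any two
    vertices of an allowed path are, because arrows are transitive; so the path
    meets each layer at most once. *)
Lemma path_of_allowed (s : seq G) :
  sorted (@arrow G) s -> exists f, path_of f = s.
Proof.
move=> s_sorted; exists [ffun i => [pick a | psi (i, a) \in s]].
apply: (irr_sorted_eq arrow_trans (@arrow_irr G)) => //.
  exact: sorted_path_of.
move=> y; case: psi_bij => psi' _ psiK; rewrite -(psiK y).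
case: (psi' y) => i a; rewrite mem_path_of ffunE.
case: pickP => [b bs|no_s]; last by rewrite no_s.
apply/eqP/idP => [[<-] //|as_].
have nlt c d : psi (i, c) \in s -> psi (i, d) \in s ->
    (index (psi (i, c)) s < index (psi (i, d)) s)%N = false.
  move=> cs ds; apply/negP => /(sorted_ltn_index arrow_trans s_sorted _ _ cs ds).
  by rewrite psi_arrow ltnn.
have eq_idx : index (psi (i, a)) s = index (psi (i, b)) s.
  by apply/anti_leq; rewrite (leqNgt (index _ _)) nlt //= leqNgt nlt.
have /(bij_inj psi_bij)[->] // : psi (i, a) = psi (i, b).
by rewrite -(nth_index (psi (i, a)) as_) eq_idx nth_index.
Qed.

Lemma path_of_remove f i : f i ->
  path_of (upd f i None) =
    take (index i (supp f)) (path_of f) ++ drop (index i (supp f)).+1 (path_of f).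
Proof.
move=> fi; rewrite /path_of -map_take -map_drop -map_cat -remE.
have -> : supp (upd f i None) = rem i (supp f).
  rewrite rem_filter ?supp_uniq // /supp -filter_predI; apply: eq_filter => j.
  by rewrite /= ffunE; case: eqP.
apply/eq_in_map => j; rewrite mem_rem_uniq ?supp_uniq // => /andP[/= ji _].
by rewrite upd_ne.
Qed.

(** The basis symbol of a list of vertices, equal to 0 unless the list is a
    regular path with q vertices; faces of paths are most easily handled as
    lists. *)
Definition seq_path q (s : seq G) : chain R G q :=
  [ffun t => (val (val t) == s :> seq G)%:R].

Lemma epath_seq_path q (t : q.-tuple G) : epath R t = seq_path q t.
Proof. by apply/ffunP => s; rewrite !ffunE. Qed.

Lemma seq_path_size q (s : seq G) : size s != q -> seq_path q s = 0.
Proof.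
move=> sq; apply/ffunP => t; rewrite !ffunE.
by case: eqP => // ts; rewrite -ts size_tuple eqxx in sq.
Qed.

Lemma sorted_regular q (t : q.-tuple G) :
  sorted (@arrow G) t -> regular t.
Proof.
apply: sub_sorted => x y xy; apply: contraTneq xy => ->.
by rewrite arrow_irr.
Qed.

Lemma val_face q (k : 'I_q.+1) (t : q.+1.-tuple G) :
  face k t = take k t ++ drop k.+1 t :> seq G.
Proof.
have kq : (k <= size t)%N by rewrite size_tuple ltnW.
apply: (@eq_from_nth _ (thead t)).
  rewrite size_cat size_takel // size_drop !size_tuple subSS subnKC //.
  by rewrite -ltnS.
move=> l; rewrite size_tuple => lq; rewrite nth_face // nth_cat size_takel //.
rewrite /bump leqNgt; case: ltnP => lk /=; first by rewrite nth_take.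
by rewrite nth_drop [(k.+1 + _)%N]addSn subnKC.
Qed.

Lemma bdry_seq_path q f :
  bdry R G q (seq_path q.+1 (path_of f)) =
    \sum_(i | f i) sgn R f i *: seq_path q (path_of (upd f i None)).
Proof.
have [fq|fq] := eqVneq (size (supp f)) q.+1; last first.
  rewrite seq_path_size ?size_path_of // linear0 big1 // => i fi.
  rewrite seq_path_size ?scaler0 // size_path_of.
  by apply: contraNneq fq => <-; rewrite (size_supp_remove fi).
have tP : size (path_of f) == q.+1 by rewrite size_path_of fq.
pose t := Tuple tP; rewrite -[path_of f]/(tval t) -epath_seq_path bdry_epathE.
rewrite -(big_supp f (fun i => sgn R f i *: seq_path q (path_of (upd f i None)))).
have [i0 _] : exists i, i \in supp f.
  by case: (supp f) fq => // i s _; exists i; rewrite mem_head.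
rewrite (big_nth i0) fq big_mkord; apply: eq_bigr => k _.
have kq : (k < size (supp f))%N by rewrite fq.
have fk : f (nth i0 (supp f) k) by rewrite -mem_supp mem_nth.
rewrite sgn_index // path_of_remove // index_uniq ?supp_uniq //.
by rewrite epath_seq_path val_face.
Qed.

Lemma seq_path_Aspace q f : seq_path q (path_of f) \in Aspace R G q.
Proof.
have [fq|fq] := eqVneq (size (supp f)) q; last first.
  by rewrite seq_path_size ?mem0v // size_path_of.
have tP : size (path_of f) == q by rewrite size_path_of fq.
rewrite -[path_of f]/(tval (Tuple tP)) -epath_seq_path; apply: memv_span.
by apply: image_f; apply: sorted_path_of.
Qed.

(** Faces of allowed paths are allowed since arrows are transitive, so that
    Omega is the whole space of allowed chains. *)
Lemma seq_path_Omega q f : seq_path q (path_of f) \in Omega R G q.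
Proof.
case: q => [|[|q]]; first exact: memvf.
  exact: seq_path_Aspace.
rewrite memv_cap seq_path_Aspace -memv_preim bdry_seq_path.
by apply: rpred_sum => i _; apply/rpredZ/seq_path_Aspace.
Qed.

Lemma Omega_allowed q (u : chain R G q) (t : regpath G q) :
  u \in Omega R G q -> ~~ allowed (val t) -> u t = 0.
Proof.
case: q u t => [|q] u t; first by case: t => t rt; rewrite /allowed tuple0.
have OA : (Omega R G q.+1 <= Aspace R G q.+1)%VS.
  by case: (q) => [|q'] //; apply: capvSl.
move=> /(subvP OA)/(coord_span (X := in_tuple _)) -> nat_.
rewrite sum_ffunE big1 // => i _; rewrite ffunE.
have := mem_nth 0 (ltn_ord i); rewrite /= => /imageP[t' t'a ->].
rewrite ffunE; case: eqP => [tt'|]; last by rewrite scaler0.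
by case/negP: nat_; rewrite tt'.
Qed.

Definition omega_path q f : omega R G q := vsproj (Omega R G q) (seq_path q (path_of f)).

Lemma val_omega_path q f : vsval (omega_path q f) = seq_path q (path_of f).
Proof. by rewrite vsprojK // seq_path_Omega. Qed.

Lemma omega_path_size q f : size (supp f) != q -> omega_path q f = 0.
Proof. by move=> fq; rewrite /omega_path seq_path_size ?linear0 ?size_path_of. Qed.

Lemma dot_seq_path q f (u : chain R G q) (t : regpath G q) :
  val (val t) = path_of f :> seq G -> dot (seq_path q (path_of f)) u = u t.
Proof.
move=> tf; rewrite /dot (bigD1 t) //= ffunE tf eqxx mul1r big1 ?addr0 // => s st.
by rewrite ffunE -tf !(inj_eq val_inj) (negPf st) mul0r.
Qed.

Lemma regpath_of q f : size (supp f) = q ->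
  exists t : regpath G q, val (val t) = path_of f :> seq G.
Proof.
move=> fq; have tP : size (path_of f) == q by rewrite size_path_of fq.
have tr : regular (Tuple tP) by apply/sorted_regular/sorted_path_of.
by exists (exist _ (Tuple tP) tr).
Qed.

Lemma dot_omega_path q f g :
  dot (vsval (omega_path q f)) (vsval (omega_path q g))
    = ((size (supp f) == q) && (f == g))%:R.
Proof.
rewrite !val_omega_path; have [fq|fq] := eqVneq; last first.
  by rewrite seq_path_size ?size_path_of // /dot big1 // => s _; rewrite ffunE mul0r.
have [t tf] := regpath_of fq.
by rewrite (dot_seq_path _ tf) ffunE tf (inj_eq path_of_inj).
Qed.

(** The allowed paths are exactly the path_of f, so these pairings are all the
    coordinates of u. *)
Lemma omega_path_separate q (u : omega R G q) :
  (forall f, size (supp f) = q -> dot (vsval (omega_path q f)) (vsval u) = 0) -> u = 0.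
Proof.
move=> u0; apply/val_inj/ffunP => t; rewrite [in RHS]ffunE.
have [ta|nta] := boolP (allowed (val t)); last first.
  by rewrite (Omega_allowed _ nta) ?subvsP.
have [f ft] := path_of_allowed ta.
have fq : size (supp f) = q by rewrite -size_path_of ft size_tuple.
by have := u0 f fq; rewrite val_omega_path (dot_seq_path _ (esym ft)).
Qed.

Lemma dot_sumr q (I : finType) (P : pred I) (F : I -> omega R G q) u :
  dot u (vsval (\sum_(i | P i) F i)) = \sum_(i | P i) dot u (vsval (F i)).
Proof.
rewrite linear_sum /dot; under eq_bigr do rewrite sum_ffunE mulr_sumr.
by rewrite exchange_big.
Qed.

Lemma dotZr q (c : R) (v : omega R G q) u :
  dot u (vsval (c *: v)) = c * dot u (vsval v).
Proof.
rewrite /dot mulr_sumr; apply: eq_bigr => s _.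
by rewrite linearZ ffunE mulrCA.
Qed.

Lemma omega_path_expand q (u : omega R G q) :
  u = \sum_f dot (vsval (omega_path q f)) (vsval u) *: omega_path q f.
Proof.
apply/eqP; rewrite -subr_eq0; apply/eqP/omega_path_separate => f fq.
rewrite [X in dot _ X]linearB dotBr dot_sumr (bigD1 f) //= dotZr dot_omega_path fq !eqxx.
rewrite mulr1 big1 ?addr0 ?subrr // => g gf.
by rewrite dotZr dot_omega_path [f == g]eq_sym (negPf gf) andbF mulr0.
Qed.

Lemma aug_bdry_omega_path q f :
  aug_bdry R G q (omega_path q.+1 f) =
    \sum_(i | f i) sgn R f i *: omega_path q (upd f i None).
Proof.
apply/val_inj; rewrite /= aug_bdryE val_omega_path bdry_seq_path linear_sum.
by apply: eq_bigr => i _; rewrite linearZ /= val_omega_path.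
Qed.

(** Pairing with the path of f, each layer i gives the same matrix entry on
    both sides: it is nonzero only when f is g with a vertex inserted at i. *)
Lemma adjoint_omega_path q g :
  adjoint (aug_bdry R G q) (omega_path q g) =
    \sum_(i | ~~ g i) sgn R g i *: \sum_a omega_path q.+1 (upd g i (Some a)).
Proof.
apply/eqP; rewrite -subr_eq0; apply/eqP/omega_path_separate => f fq.
rewrite [X in dot _ X]linearB dotBr -adjointP aug_bdry_omega_path.
rewrite dotC !dot_sumr big_mkcond [X in _ - X]big_mkcond -sumrB big1 // => i _.
rewrite !dotZr dot_sumr dot_omega_path.
under [X in _ - (if _ then _ * X else _)]eq_bigr => a _ do
  rewrite dot_omega_path fq eqxx /=.
apply/eqP; rewrite subr_eq0; apply/eqP.
case fi: (f i) => [b|] /=; last first.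
  case: ifP => // gi; rewrite big1 ?mulr0 // => a _.
  by case: eqP => // fg; rewrite fg upd_eq in fi.
have [gf|gf] := eqVneq g (upd f i None).
  have gq : size (supp g) = q.
    by apply/succn_inj; rewrite -fq gf -size_supp_remove ?fi.
  rewrite gq eqxx gf upd_eq sgn_upd_le //=; congr (_ * _).
  rewrite (bigD1 b) //= upd_upd -fi upd_id eqxx big1 ?addr0 // => a ab.
  rewrite upd_upd; case: eqP => // fa.
  by move: fi; rewrite fa upd_eq => -[aE]; rewrite aE eqxx in ab.
rewrite andbF mulr0; case: ifP => // gi; rewrite big1 ?mulr0 // => a _.
case: eqP => // fg; case/eqP: gf; rewrite fg upd_upd -[LHS](upd_id g i).
by case: (g i) gi.
Qed.


(** A term of the Laplacian that moves the path off its own fibre: a vertex is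
    inserted at layer i and the vertex of another layer j is removed. *)
Definition cross_term q g i j : omega R G q :=
  \sum_a (sgn R g i * sgn R (upd g i (Some a)) j)
    *: omega_path q (upd (upd g i (Some a)) j None).

(** Inserting and then removing at the same layer i gives back g, once for each
    vertex of the layer. *)
Lemma bdry_adjoint_omega_path q g :
  aug_bdry R G q (adjoint (aug_bdry R G q) (omega_path q g)) =
    \sum_(i | ~~ g i) m.+1%:R *: omega_path q g
    + \sum_(i | ~~ g i) \sum_(j | g j) cross_term q g i j.
Proof.
rewrite adjoint_omega_path linear_sum -big_split; apply: eq_bigr => i gi.
have gij j : g j -> j != i by move=> gj; apply: contraTneq gj => ->.
rewrite linearZ linear_sum exchange_big /= scaler_sumr.
transitivity (\sum_(a < m.+1) (omega_path q g + \sum_(j | g j)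
  (sgn R g i * sgn R (upd g i (Some a)) j)
    *: omega_path q (upd (upd g i (Some a)) j None))); last first.
  by rewrite big_split sumr_const card_ord scaler_nat.
apply: eq_bigr => a _; rewrite aug_bdry_omega_path (bigD1 i) /= ?upd_eq //.
rewrite scalerDr scalerA sgn_upd_le // sgn_sqr scale1r upd_upd; congr (_ + _).
  by congr (omega_path q _); rewrite -[RHS](upd_id g i); case: (g i) gi.
rewrite scaler_sumr; apply: eq_big => [j|j _]; last by rewrite scalerA.
by rewrite ffunE; case: eqVneq => [->|]; rewrite ?andbF ?andbT //; case: (g i) gi.
Qed.

(** Removing and then refilling the same layer j replaces the vertex of g there
    by an arbitrary one; the other terms are those of the opposite order, with
    the opposite sign. *)
Lemma adjoint_bdry_omega_path q g :
  adjoint (aug_bdry R G q) (aug_bdry R G q (omega_path q.+1 g)) =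
    \sum_(j | g j) \sum_a omega_path q.+1 (upd g j (Some a))
    - \sum_(i | ~~ g i) \sum_(j | g j) cross_term q.+1 g i j.
Proof.
rewrite aug_bdry_omega_path linear_sum [X in _ - X]exchange_big -sumrB.
apply: eq_bigr => j gj.
rewrite linearZ /= adjoint_omega_path (bigD1 j) /= ?upd_eq //.
rewrite scalerDr scalerA sgn_upd_le // sgn_sqr scale1r; congr (_ + _).
  by apply: eq_bigr => a _; rewrite upd_upd.
rewrite scaler_sumr -sumrN; apply: eq_big => [i|i /andP[gi ij]].
  by rewrite ffunE; case: eqVneq => [->|]; rewrite ?gj ?andbF ?andbT.
rewrite upd_ne // in gi; rewrite scalerA scaler_sumr -sumrN.
apply: eq_bigr => a _; rewrite -scaleNr (sgn_anticomm _ ij gi gj) // opprK.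
by rewrite updC // eq_sym.
Qed.

(** The cross terms of the two halves of the Laplacian cancel, and there
    remains a sum of commuting operators, one for each layer: the Laplacian of
    a join of complexes is the sum of the Laplacians of the factors. *)
Lemma aug_laplacian_omega_path q g :
  aug_laplacian R G q (omega_path q g) = \sum_i factor_laplacian (omega_path q) i g.
Proof.
have [gq|gq] := eqVneq (size (supp g)) q; last first.
  rewrite omega_path_size // linear0 big1 // => i _; rewrite /factor_laplacian.
  rewrite omega_path_size // scaler0; case: ifP => // gi; apply: big1 => a _.
  rewrite omega_path_size //; apply: contraNneq gq => <-.
  by rewrite size_supp_upd (size_supp_remove gi).
have -> : \sum_i factor_laplacian (omega_path q) i g =
    \sum_(i | ~~ g i) m.+1%:R *: omega_path q g
    + \sum_(j | g j) \sum_a omega_path q (upd g j (Some a)).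
  rewrite (bigID (fun i => ~~ g i)) /=; congr (_ + _).
    by apply: eq_bigr => i /negPf gi; rewrite /factor_laplacian gi.
  apply: eq_big => [i|i gi]; first by rewrite negbK.
  by rewrite /factor_laplacian -(negbK (isSome _)) gi.
case: q gq => [|q] gq.
  have no_g j : (g j : bool) = false by rewrite -mem_supp (size0nil gq).
  rewrite /aug_laplacian /= comp_lfunE bdry_adjoint_omega_path; congr (_ + _).
  rewrite [RHS]big_pred0 // big1 // => i _; exact: big_pred0.
rewrite /aug_laplacian /= add_lfunE !comp_lfunE.
rewrite bdry_adjoint_omega_path adjoint_bdry_omega_path.
by rewrite addrACA subrr addr0.
Qed.

(** The tensor products of single-factor eigenvectors are eigenvectors, and
    they form a basis because the tensor transition matrix is invertible.
    Passing to one degree is harmless since a tensor eigenvector only involves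
    partial functions with the same domain as its label. *)
Lemma dim_aug_laplacian_eigenspace q a :
  \dim (passmx.leigenspace (aug_laplacian R G q) a) =
    #|[pred x : partial_fun |
        (size (supp x) == q) && (\sum_i eigval R (x i) == a)]|.
Proof.
pose b x : omega R G q := \sum_f tensor_eigvec R x f *: omega_path q f.
apply: (dim_leigenspace_eigenbasis (b := b)).
- move=> x _; rewrite /b linear_sum.
  under eq_bigr do rewrite linearZ /= aug_laplacian_omega_path scaler_sumr.
  rewrite exchange_big scaler_suml; apply: eq_bigr => i _.
  exact: factor_laplacian_eigen.
- move=> c c0 y /eqP yq.
  (* For f of another size every summand vanishes, so the relation holds for all
     f and the full tensor inverse may be applied to it. *)
  have c0f f : \sum_(x | size (supp x) == q) c x * tensor_eigvec R x f = 0.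
    have [fq|fq] := eqVneq (size (supp f)) q; last first.
      by apply: big1 => x /eqP xq; rewrite tensor_eigvec_size ?mulr0 // xq eq_sym.
    have : dot (vsval (omega_path q f))
        (vsval (\sum_(x | size (supp x) == q) c x *: b x)) = 0.
      by rewrite c0 /dot big1 // => s _; rewrite linear0 ffunE mulr0.
    rewrite dot_sumr => {2}<-; apply: eq_bigr => x _; rewrite dotZr dot_sumr.
    rewrite (bigD1 f) //= dotZr dot_omega_path fq !eqxx mulr1 big1 ?addr0 // => g gf.
    by rewrite dotZr dot_omega_path [f == g]eq_sym (negPf gf) andbF mulr0.
  have : \sum_f (\sum_(x | size (supp x) == q) c x * tensor_eigvec R x f)
             * tensor_eigvec_inv R f y = 0.
    by apply: big1 => f _; rewrite c0f mul0r.
  under eq_bigr do rewrite mulr_suml.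
  rewrite exchange_big (bigD1 y) ?yq //=.
  under eq_bigr do rewrite -mulrA; rewrite -mulr_sumr tensor_eigvecK eqxx mulr1.
  rewrite big1 ?addr0 // => x /andP[_ xy].
  under eq_bigr do rewrite -mulrA; rewrite -mulr_sumr tensor_eigvecK.
  by rewrite (negPf xy) mulr0.
- move=> u; exists (fun x => \sum_f dot (vsval (omega_path q f)) (vsval u)
                                    * tensor_eigvec_inv R f x).
  rewrite {1}(omega_path_expand u) [RHS]big_mkcond /=.
  transitivity (\sum_x (\sum_f dot (vsval (omega_path q f)) (vsval u)
                    * tensor_eigvec_inv R f x) *: b x); last first.
    apply: eq_bigr => x _; case: ifP => // /negbT xq.
    rewrite [b x]big1 ?scaler0 // => f _.
    have [fq|fq] := eqVneq (size (supp f)) q; last by rewrite omega_path_size ?scaler0.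
    by rewrite tensor_eigvec_size ?scale0r // fq.
  under [RHS]eq_bigr do rewrite scaler_suml.
  rewrite exchange_big; apply: eq_bigr => f _.
  under eq_bigr do rewrite -scalerA; rewrite -scaler_sumr; congr (_ *: _).
  under eq_bigr do rewrite /b scaler_sumr.
  rewrite exchange_big (bigD1 f) //=.
  under eq_bigr do rewrite scalerA; rewrite -scaler_suml tensor_eigvec_invK.
  rewrite eqxx scale1r big1 ?addr0 // => g gf.
  under eq_bigr do rewrite scalerA; rewrite -scaler_suml tensor_eigvec_invK.
  by rewrite eq_sym (negPf gf) scale0r.
Qed.

End PathsOfLayeredDigraph.

(** * Powers of the discrete digraph *)

(** The only feature of D_m^n that the spectrum depends on: vertices are pairs
    of a layer and an element of the layer, and arrows go from lower to higher
    layers. *)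
Lemma join_power_layers m n :
  exists2 psi : 'I_n.+1 * 'I_m -> join_power (discrete m) n.+1,
    bijective psi & forall p p', arrow (psi p) (psi p') = (p.1 < p'.1)%N.
Proof.
elim: n => [|n [psi [psi' psiK psi'K] psi_arrow]].
  exists (fun p : 'I_1 * 'I_m => p.2 : join_power (discrete m) 1).
    exists (fun a : 'I_m => (ord0, a)) => // -[i a].
    by rewrite [i]ord1.
  by move=> [i a] [j b] /=; rewrite [i]ord1 [j]ord1.
pose X := join_power (discrete m) n.+1.
pose phi (p : 'I_n.+2 * 'I_m) : djoin (discrete m) X :=
  if unlift ord0 p.1 is Some j then inr (psi (j, p.2)) else inl p.2.
pose phi' (y : djoin (discrete m) X) : 'I_n.+2 * 'I_m :=
  match y with
  | inl a => (ord0, a)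
  | inr y => (lift ord0 (psi' y).1, (psi' y).2)
  end.
exists phi.
  exists phi' => [[i a]|[a|y]] /=; rewrite /phi /=.
  - by case: unliftP => [j|] -> //=; rewrite psiK.
  - by rewrite unlift_none.
  - by rewrite liftK -surjective_pairing psi'K.
move=> [i a] [j b]; rewrite /phi /=.
case: unliftP => [i'|] ->; case: unliftP => [j'|] -> //=.
Qed.

Theorem theorem9p3 (R : realType) (n m : nat) (n_ge1 : (1 <= n)%N)
    (m_ge1 : (1 <= m)%N) :
  (forall r : nat,
     is_spectrum (aug_laplacian R (join_power (discrete m) n) r)
       (flatten [seq nseq ((m - 1) ^ k * 'C(r, k) * 'C(n, r))%N
                          ((n%:R - k%:R) * m%:R : R)
                | k <- iota 0 r.+1]))
  /\
  (forall r : nat, (2 <= r)%N ->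
     is_spectrum (path_laplacian R (join_power (discrete m) n) (r - 1)%N)
       (flatten [seq nseq ((m - 1) ^ k * 'C(r, k) * 'C(n, r))%N
                          ((n%:R - k%:R) * m%:R : R)
                | k <- iota 0 r.+1])).
Proof.
case: n m n_ge1 m_ge1 => [|n] // [|m] // _ _.
have [psi psi_bij psi_arrow] := join_power_layers m.+1 n.
have aug_spec r : is_spectrum
    (aug_laplacian R (join_power (discrete m.+1) n.+1) r)
    (flatten [seq nseq ((m.+1 - 1) ^ k * 'C(r, k) * 'C(n.+1, r))%N
                       ((n.+1%:R - k%:R) * m.+1%:R : R) | k <- iota 0 r.+1]).
  move=> a; rewrite (dim_aug_laplacian_eigenspace psi_bij psi_arrow).
  by rewrite -count_mem_spectrum subn1.
by split=> // -[|[|r]] // _; exact: aug_spec r.+2.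
Qed.
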